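(* For all integers $k\ge n\ge 1$, we have $c_{n,k}\ge \pi-2\,\mathrm{cov}_{\mathbb{RP}^n}(k)$, where $c_{n,k}=\inf\{r\ge 0\mid \text{there exists an odd map } S^k\to \mathrm{VR}(S^n;r)\}$.
   Context: $S^n=\{x\in\mathbb{R}^{n+1}\mid \|x\|=1\}$ carries the geodesic metric $d_{S^n}(x,x')=\arccos\langle x,x'\rangle$, with involution $x\mapsto -x$. A ''map'' is a continuous function. A map between spaces with involutions (both written $x\mapsto -x$) is odd if $f(-x)=-f(x)$ for all $x$. For a metric space $X$ and $r\ge 0$, the Vietoris--Rips complex $\mathrm{VR}(X;r)$ is the simplicial complex with vertex set $X$ whose simplices are the nonempty finite subsets $\sigma\subseteq X$ with $\operatorname{diam}(\sigma)\le r$; it is identified with its geometric realization. If $X$ has an isometric involution $x\mapsto -x$, then $\mathrm{VR}(X;r)$ has the involution $-\left(\sum_i\lambda_i x_i\right)=\sum_i\lambda_i(-x_i)$. $\mathbb{RP}^n=S^n/(x\sim -x)$ carries the quotient metric $d_{\mathbb{RP}^n}(\{x,-x\},\{x',-x'\})=\min(d_{S^n}(x,x'),d_{S^n}(x,-x'))$. For a metric space $X$, $\mathrm{cov}_X(k)$ is the infimum of all $\varepsilon>0$ such that there is a finite set $A\subseteq X$ with $|A|\le k$ for which the open balls of radius $\varepsilon$ about the points of $A$ cover $X$. *)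

(* Defs.v *)
From HB Require Import structures.
From mathcomp Require Import all_boot all_order all_algebra.
From mathcomp Require Import finmap.
From mathcomp Require Import all_classical all_reals all_analysis.
From mathcomp Require Import ring lra.

Set Implicit Arguments.
Unset Strict Implicit.
Unset Printing Implicit Defensive.

Import Order.TTheory GRing.Theory Num.Theory.
Import numFieldNormedType.Exports.

Local Open Scope classical_set_scope.
Local Open Scope ring_scope.

Section Euclidean.
Variables (R : realType) (n : nat).
Implicit Types u v w : 'rV[R]_n.

Definition dot u v : R := \sum_i u 0 i * v 0 i.

(* The library norm [`|u|] on ['rV[R]_n] is the sup norm. *)
Definition enorm u : R := Num.sqrt (dot u u).

Lemma dotC u v : dot u v = dot v u.
Proof. by apply: eq_bigr => i _; rewrite mulrC. Qed.

Lemma dotDl u v w : dot (u + v) w = dot u w + dot v w.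
Proof.
by rewrite /dot -big_split; apply: eq_bigr => i _; rewrite mxE mulrDl.
Qed.

Lemma dotZl (a : R) u w : dot (a *: u) w = a * dot u w.
Proof.
by rewrite /dot mulr_sumr; apply: eq_bigr => i _; rewrite mxE mulrA.
Qed.

Lemma dotNl u w : dot (- u) w = - dot u w.
Proof. by rewrite -scaleN1r dotZl mulN1r. Qed.

Lemma dotDr u v w : dot w (u + v) = dot w u + dot w v.
Proof. by rewrite dotC dotDl !(dotC w). Qed.

Lemma dotZr (a : R) u w : dot w (a *: u) = a * dot w u.
Proof. by rewrite dotC dotZl dotC. Qed.

Lemma dotNr u w : dot w (- u) = - dot w u.
Proof. by rewrite dotC dotNl dotC. Qed.

Definition dotE := (dotDl, dotDr, dotNl, dotNr, dotZl, dotZr).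

Lemma dot_ge0 u : 0 <= dot u u.
Proof. by apply: sumr_ge0 => i _; rewrite -expr2 sqr_ge0. Qed.

Lemma dot_eq0 u : dot u u = 0 -> u = 0.
Proof.
move=> u0; apply/rowP => i; rewrite mxE; apply/eqP.
have /psumr_eq0P : forall i : 'I_n, true -> 0 <= u 0 i * u 0 i.
  by move=> j _; rewrite -expr2 sqr_ge0.
by move=> /(_ u0 i isT)/eqP; rewrite mulf_eq0 orbb.
Qed.

Lemma dot_CauchySchwarz u v : dot u v ^+ 2 <= dot u u * dot v v.
Proof.
have [v0|v0] := eqVneq (dot v v) 0.
  have -> : dot u v = 0 by rewrite (dot_eq0 v0) -(scale0r 0) dotZr mul0r.
  by rewrite v0 expr0n mulr0.
have vgt0 : 0 < dot v v by rewrite lt_neqAle eq_sym v0 dot_ge0.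
have := dot_ge0 (dot v v *: u - dot u v *: v).
rewrite !dotE (dotC v u).
set a := dot u u; set b := dot u v; set c := dot v v => h.
rewrite -subr_ge0 -(pmulr_rge0 _ vgt0) -/c.
by move: h; congr (0 <= _); ring.
Qed.

End Euclidean.

Section Sphere.
Variables (R : realType) (n : nat).

Record sphere := Sphere {
  sphere_val :> 'rV[R]_n.+1;
  sphere_valP : enorm sphere_val == 1 }.

HB.instance Definition _ := [isSub for sphere_val].
HB.instance Definition _ := [Choice of sphere by <:].

Implicit Types x y z : sphere.

Lemma sphere_dot1 x : dot x x = 1.
Proof.
rewrite -(sqr_sqrtr (dot_ge0 x)).
by rewrite -/(enorm x) (eqP (sphere_valP x)) expr1n.
Qed.

Lemma sphere_opp_subproof x : enorm (- sphere_val x) == 1.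
Proof. by rewrite /enorm !dotE opprK sphere_dot1 sqrtr1. Qed.

Definition sphere_opp x := Sphere (sphere_opp_subproof x).

Lemma sphere_oppK : involutive sphere_opp.
Proof. by move=> x; apply: val_inj; rewrite /= opprK. Qed.

Definition geod x y : R := acos (dot x y).

Lemma sphere_dot_itv x y : -1 <= dot x y <= 1.
Proof.
have := dot_CauchySchwarz x y; rewrite !sphere_dot1 mulr1 => d1.
by apply/andP; split; nra.
Qed.

Lemma geodxx x : geod x x = 0.
Proof. by rewrite /geod sphere_dot1 acos1. Qed.

Lemma geod_sym x y : geod x y = geod y x.
Proof. by rewrite /geod dotC. Qed.

Lemma geod_ge0 x y : 0 <= geod x y.
Proof. exact/acos_ge0/sphere_dot_itv. Qed.

Lemma geod_lepi x y : geod x y <= pi.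
Proof. exact/acos_lepi/sphere_dot_itv. Qed.

Lemma cos_geod x y : cos (geod x y) = dot x y.
Proof. by rewrite acosK // in_itv /= sphere_dot_itv. Qed.

Lemma geod_positivity x y : geod x y = 0 -> x = y.
Proof.
move=> xy0; have xy1 : dot x y = 1 by rewrite -cos_geod xy0 cos0.
apply: val_inj => /=; apply/eqP; rewrite -subr_eq0; apply/eqP/dot_eq0.
by rewrite !dotE (dotC y x) xy1 !sphere_dot1; ring.
Qed.

Lemma geod_triangle y x z : geod x z <= geod x y + geod y z.
Proof.
have [gt_pi|le_pi] := ltP pi (geod x y + geod y z).
  exact: le_trans (geod_lepi _ _) (ltW gt_pi).
rewrite leNgt -ltr_cos ?in_itv /= ?geod_ge0 ?geod_lepi ?addr_ge0 ?geod_ge0 //.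
rewrite -leNgt cosD !cos_geod /geod !sin_acos ?sphere_dot_itv //.
have /andP[a1 a2] := sphere_dot_itv x y; have /andP[b1 b2] := sphere_dot_itv y z.
set a := dot x y in a1 a2 *; set b := dot y z in b1 b2 *.
have a0 : 0 <= 1 - a ^+ 2 by nra.
rewrite -sqrtrM // lerBlDr -lerBlDl.
apply: le_trans (ler_norm _) _; rewrite -sqrtr_sqr ler_sqrt; last first.
  by rewrite mulr_ge0 //; nra.
have := dot_CauchySchwarz (sphere_val x - a *: sphere_val y)
  (sphere_val z - b *: sphere_val y).
rewrite !dotE (dotC y x) (dotC z y) !sphere_dot1 -/a -/b.
set c := dot x z => h.
have -> : (a * b - c) ^+ 2 =
  (c - b * a - (a * b - a * (b * 1))) ^+ 2 by ring.
by move: h; congr (_ <= _); ring.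
Qed.

HB.instance Definition _ := isMetric.Build R sphere
  geodxx geod_positivity geod_sym geod_triangle.

Lemma geod_opp x y : geod (sphere_opp x) (sphere_opp y) = geod x y.
Proof. by rewrite /geod !dotE opprK. Qed.

Lemma geod_oppl x y : geod (sphere_opp x) y = geod x (sphere_opp y).
Proof. by rewrite /geod !dotE. Qed.

End Sphere.

Section ProjectiveSpace.
Variables (R : realType) (n : nat).
Local Notation S := (sphere R n).
Local Open Scope quotient_scope.

Definition antipodal (x y : S) := (y == x) || (y == sphere_opp x).

Lemma antipodal_refl : reflexive antipodal.
Proof. by move=> x; rewrite /antipodal eqxx. Qed.

Lemma antipodal_sym : symmetric antipodal.
Proof.
move=> x y; rewrite /antipodal eq_sym; congr (_ || _).
by rewrite -(inj_eq (can_inj (@sphere_oppK R n))) sphere_oppK eq_sym.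
Qed.

Lemma antipodal_trans : transitive antipodal.
Proof.
move=> y x z /orP[] /eqP-> /orP[] /eqP->; rewrite /antipodal ?sphere_oppK.
all: by rewrite eqxx ?orbT.
Qed.

Canonical antipodal_equiv :=
  EquivRel antipodal antipodal_refl antipodal_sym antipodal_trans.

Definition RP := {eq_quot antipodal}.

HB.instance Definition _ := Choice.on RP.
HB.instance Definition _ := Quotient.on RP.

Implicit Types p q : RP.

Definition geodRP p q : R :=
  Num.min (geod (repr p) (repr q)) (geod (repr p) (sphere_opp (repr q))).

Lemma geodRP_pi (x y : S) :
  geodRP (\pi_RP x) (\pi_RP y) = Num.min (geod x y) (geod x (sphere_opp y)).
Proof.
rewrite /geodRP.
have repr_pi (z : S) :
    repr (\pi_RP z) = z \/ repr (\pi_RP z) = sphere_opp z.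
  have : antipodal z (repr (\pi_RP z)).
    by apply/(@eqmodP _ antipodal_equiv); rewrite reprK.
  by move=> /orP[] /eqP; [left|right].
have [->|->] := repr_pi x; have [->|->] := repr_pi y;
  by rewrite ?geod_oppl ?sphere_oppK // minC.
Qed.

Lemma geodRPxx p : geodRP p p = 0.
Proof. by rewrite /geodRP geodxx min_l // geod_ge0. Qed.

Lemma geodRP_positivity p q : geodRP p q = 0 -> p = q.
Proof.
rewrite -[p]reprK -[q]reprK geodRP_pi minEle.
case: ifP => _ /geod_positivity H; last first.
  apply/(@eqmodP _ antipodal_equiv); rewrite /= H /antipodal sphere_oppK.
  by rewrite eqxx orbT.
by rewrite H.
Qed.

Lemma geodRP_sym p q : geodRP p q = geodRP q p.
Proof. by rewrite /geodRP geod_sym [in X in Num.min _ X]geod_sym geod_oppl. Qed.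

Lemma geodRP_triangle q p r : geodRP p r <= geodRP p q + geodRP q r.
Proof.
rewrite /geodRP; set x := repr p; set y := repr q; set z := repr r.
rewrite [in X in _ <= X + _]minEle [in X in _ <= _ + X]minEle ge_min.
case: ifP => _; case: ifP => _.
- by rewrite geod_triangle.
- by rewrite geod_triangle orbT.
- by rewrite -[geod y z]geod_opp geod_triangle orbT.
- by rewrite -(geod_oppl y z) geod_triangle.
Qed.

HB.instance Definition _ := isMetric.Build R RP
  geodRPxx geodRP_positivity geodRP_sym geodRP_triangle.

End ProjectiveSpace.

(* [inf set0 = 0], but the set below is nonempty as soon as [X] is nonempty and
   bounded and [0 < k]. *)
Definition cov (R : realType) (X : metricType R) (k : nat) : R :=
  inf [set e : R | 0 < e /\ exists A : {fset X},
    (#|` A| <= k)%N /\ \bigcup_(a in [set` A]) ball a e = [set: X]].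

Record simplicial_complex (V : choiceType) := SimplicialComplex {
  simplices :> {fset V} -> Prop;
  simplex_neq0 : forall s, simplices s -> s != fset0;
  simplex_face : forall s t,
    simplices s -> (t `<=` s)%fset -> t != fset0 -> simplices t }.

(* The point [\sum_i l_i v_i] of the realization is encoded by its family of
   barycentric coordinates, extended by 0 to all vertices. *)
Section Realization.
Variables (R : realType) (V : choiceType) (K : simplicial_complex V).

Definition barycentric (w : {fsfun V -> R with 0}) : Prop :=
  [/\ forall v, 0 <= w v, \sum_(v <- finsupp w) w v = 1 & K (finsupp w)].

Record realization := Realization {
  coord :> {fsfun V -> R with 0};
  coordP : `[< barycentric coord >] }.

HB.instance Definition _ := [isSub for coord].
HB.instance Definition _ := [Choice of realization by <:].

Definition closed_simplex (s : {fset V}) : set realization :=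
  [set w | (finsupp (coord w) `<=` s)%fset].

(* Weak topology: a set is open iff its trace on every closed simplex [s] is
   open for the Euclidean topology of [R^s], here given by the sup norm. *)
Definition realization_open (U : set realization) : Prop :=
  forall s, K s -> forall w, closed_simplex s w -> U w ->
  exists2 e : R, 0 < e & forall w', closed_simplex s w' ->
    (forall v, v \in s -> `|w v - w' v| < e) -> U w'.

Lemma realization_openT : realization_open setT.
Proof. by move=> s Ks w sw _; exists 1. Qed.

Lemma realization_openI : setI_closed realization_open.
Proof.
move=> A B oA oB s Ks w sw [Aw Bw].
have [e e0 eA] := oA s Ks w sw Aw; have [f f0 fB] := oB s Ks w sw Bw.
exists (Num.min e f); first by rewrite lt_min e0.
by move=> w' sw' d; split; [apply: eA|apply: fB] => // v /d;
  rewrite lt_min => /andP[].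
Qed.

Lemma realization_open_bigU (I : Type) (f : I -> set realization) :
  (forall i, realization_open (f i)) -> realization_open (\bigcup_i f i).
Proof.
move=> of_ s Ks w sw [i _ fiw]; have [e e0 ei] := of_ i s Ks w sw fiw.
by exists e => // w' sw' d; exists i => //; apply: ei.
Qed.

HB.instance Definition _ := isOpenTopological.Build realization
  realization_openT realization_openI realization_open_bigU.

End Realization.

Arguments realization R {V} K.

Section VietorisRips.
Variables (R : realType) (X : metricType R).

Definition diam (s : {fset X}) : R :=
  \big[Num.max/0]_(x <- s) \big[Num.max/0]_(y <- s) mdist x y.

Lemma diam_leP (s : {fset X}) (r : R) : 0 <= r ->
  diam s <= r <-> (forall x y, x \in s -> y \in s -> mdist x y <= r).
Proof.
move=> r0; rewrite /diam; split=> [h x y xs ys|h].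
  apply: le_trans h.
  apply: (@le_trans _ _ (\big[Num.max/0]_(y0 <- s) mdist x y0)).
    by apply: le_bigmax_seq.
  by apply: le_bigmax_seq xs _.
rewrite big_seq; apply: bigmax_le => // x xs.
by rewrite big_seq; apply: bigmax_le => // y ys; apply: h.
Qed.

Lemma diam_ge0 (s : {fset X}) : 0 <= diam s.
Proof. by rewrite /diam; apply: bigmax_ge_id. Qed.

Variable r : R.

Let vr_simplices (s : {fset X}) : Prop := s != fset0 /\ diam s <= r.

Let vr_neq0 s : vr_simplices s -> s != fset0.
Proof. by case. Qed.

Let vr_face s t : vr_simplices s -> (t `<=` s)%fset -> t != fset0 ->
  vr_simplices t.
Proof.
move=> [_ sr] /fsubsetP ts t0; split=> //.
have r0 : 0 <= r := le_trans (diam_ge0 s) sr.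
have [h _] := diam_leP s r0; have [_ h'] := diam_leP t r0.
by apply: h' => x y /ts xs /ts ys; exact: h.
Qed.

Definition VR := SimplicialComplex vr_neq0 vr_face.

End VietorisRips.

Record isometric_involution (R : realType) (X : metricType R) :=
  IsometricInvolution {
    invol :> X -> X;
    involK : involutive invol;
    invol_mdist : forall x y, mdist (invol x) (invol y) = mdist x y }.

Section VRInvolution.
Variables (R : realType) (X : metricType R) (i : isometric_involution X).

(* The coefficient of [y] in [\sum_x w x (i x)] is [w (i y)]. *)
Definition VR_opp_coord (w : {fsfun X -> R with 0}) : {fsfun X -> R with 0} :=
  [fsfun y in [fset i x | x in finsupp w]%fset => w (i y)].

Lemma VR_opp_coordE w y : VR_opp_coord w y = w (i y).
Proof.
rewrite fsfunE; case: ifPn => // /negP ny; apply/esym/eqP.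
apply/negPn/negP => wy; apply: ny; apply/imfsetP; exists (i y).
  by rewrite mem_finsupp.
by rewrite involK.
Qed.

Lemma finsupp_VR_opp_coord w :
  finsupp (VR_opp_coord w) = [fset i x | x in finsupp w]%fset.
Proof.
apply/fsetP => y; rewrite mem_finsupp VR_opp_coordE; apply/idP/imfsetP.
  by move=> wy; exists (i y); rewrite ?involK // mem_finsupp.
by move=> [x]; rewrite mem_finsupp => wx ->; rewrite involK.
Qed.

Variable r : R.

Lemma VR_opp_subproof (w : realization R (VR X r)) :
  `[< barycentric (VR X r) (VR_opp_coord w) >].
Proof.
have /asboolP [w0 w1 [wn wr]] := coordP w; apply/asboolP.
have r0 : 0 <= r := le_trans (diam_ge0 _) wr.
split; first by move=> v; rewrite VR_opp_coordE.
  rewrite finsupp_VR_opp_coord big_imfset /=; last first.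
    by move=> x y _ _ /(can_inj (involK i)).
  by rewrite -[RHS]w1; apply: eq_bigr => x _; rewrite VR_opp_coordE involK.
rewrite finsupp_VR_opp_coord; split.
  have /fset0Pn[x xw] := wn; apply/fset0Pn; exists (i x).
  by apply/imfsetP; exists x.
have [h _] := diam_leP (finsupp w) r0.
have [_ h'] := diam_leP [fset i x | x in finsupp w]%fset r0.
apply: h' => _ _ /imfsetP[x xw ->] /imfsetP[y yw ->].
by rewrite invol_mdist; exact: h.
Qed.

Definition VR_opp (w : realization R (VR X r)) : realization R (VR X r) :=
  Realization (VR_opp_subproof w).

Lemma VR_oppK : involutive VR_opp.
Proof.
by move=> w; apply/val_inj/fsfunP => x; rewrite !VR_opp_coordE involK.
Qed.

End VRInvolution.

Definition sphere_antipode (R : realType) (n : nat) :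
    isometric_involution (sphere R n) :=
  IsometricInvolution (@sphere_oppK R n) (@geod_opp R n).

Definition odd_map (T U : topologicalType) (iT : T -> T) (iU : U -> U)
    (f : T -> U) : Prop :=
  continuous f /\ forall x, f (iT x) = iU (f x).

(* The set below contains [pi]: every nonempty finite subset of the sphere is a
   simplex, and the midpoint of [x] and [- x] is fixed by the involution. *)
Definition c_ (R : realType) (n k : nat) : R :=
  inf [set r : R | 0 <= r /\
    exists f : sphere R k -> realization R (VR (sphere R n) r),
      odd_map (@sphere_opp R k) (@VR_opp R _ (sphere_antipode R n) r) f].

(* Main.v *)
Require Import Defs.
From mathcomp Require Import all_boot all_order all_algebra.
From mathcomp Require Import finmap.
From mathcomp Require Import all_classical all_reals all_analysis.
From mathcomp Require Import lra.

(** Suppose that [r < pi - 2 * e], that the balls of radius [e] about at most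
[k] points [{a, - a}] of the projective space cover it, and that [f] is an odd
map from the [k]-sphere to the Vietoris-Rips complex at scale [r].  For each
[a], give a point of the sphere the value [1] if it is within [e] of [a], [-1]
if it is within [e] of [- a], and [0] otherwise, and extend this value linearly
to the complex.  A point close to [a] and a point close to [- a] are more than
[pi - 2 * e] apart, so a simplex never contains both: on each simplex the
values for a given [a] have a constant sign, and nothing cancels in the linear
extension ([linear_extension_cap_sign_gt0]).  As every vertex is close to some
[a] or [- a], the linear extensions have no common zero.  Composed with [f]
they are at most [k] continuous odd real functions on the [k]-sphere without
common zero, against the Borsuk-Ulam theorem.

The Borsuk-Ulam theorem ([borsuk_ulam]) is proved with chains and cochains
modulo 2.  Let [F_1, ..., F_m] be odd without common zero, [m <= k], and let
[s_i] be the sign of [F_i], an odd boolean function.  The cochain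
[cup s [:: 1; ...; m]] sends a tuple [(v_0, ..., v_m)] to the product of the
[s_i v_(i-1) + s_i v_i], that is, it is the cup product of the coboundaries of
the [s_i].  Two computations of its value on a suitable chain disagree.
- The [m]-dimensional hemisphere of the octahedral sphere has as boundary the
  [(m-1)]-dimensional hemisphere plus its antipode.  As [s_1] is odd, integration
  by parts removes one factor of the product and one dimension, down to the
  value [1] at a single point ([pairing_cup_hemispheres]).  Barycentric
  subdivision keeps these boundary relations.
- On a small enough simplex some [F_i] keeps a constant sign
  ([sign_lebesgue_number]), so that one factor vanishes ([cup_eq0]). *)

Set Implicit Arguments.
Unset Strict Implicit.
Unset Printing Implicit Defensive.

Import Order.TTheory GRing.Theory Num.Theory.
Import numFieldNormedType.Exports.

Local Open Scope classical_set_scope.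
Local Open Scope ring_scope.

(** * Chains modulo 2 *)

Section Chains.
Variable V : Type.
Implicit Types (t u : seq V) (c : seq (seq V)) (phi : seq V -> bool).

(** Defined by recursion on the tuple, so that [coboundary_cons] holds by
computation: the faces of a cone are its base and the cones over the faces of
the base.  The empty tuple is a face of every vertex, so that the complex is
augmented and the cone formula needs no exception in dimension 0. *)
Fixpoint faces t : seq (seq V) :=
  if t is v :: t' then t' :: [seq v :: u | u <- faces t'] else [::].

Definition boundary c : seq (seq V) := flatten [seq faces t | t <- c].

(** A chain modulo 2 is only considered through its pairing with cochains:
tuples occurring twice in a list cancel there. *)
Definition pairing phi c : bool := \big[addb/false]_(t <- c) phi t.

Definition coboundary phi t : bool := pairing phi (faces t).

Lemma pairing_nil phi : pairing phi [::] = false.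
Proof. exact: big_nil. Qed.

Lemma pairing_cons phi t c : pairing phi (t :: c) = phi t (+) pairing phi c.
Proof. exact: big_cons. Qed.

Lemma pairing_cat phi c1 c2 :
  pairing phi (c1 ++ c2) = pairing phi c1 (+) pairing phi c2.
Proof. exact: big_cat. Qed.

Lemma pairing_map phi (g : seq V -> seq V) c :
  pairing phi (map g c) = pairing (fun t => phi (g t)) c.
Proof. exact: big_map. Qed.

Lemma pairing_flatten phi (F : seq V -> seq (seq V)) c :
  pairing phi (flatten [seq F t | t <- c]) =
  pairing (fun t => pairing phi (F t)) c.
Proof. by rewrite /pairing big_flatten big_map. Qed.

Lemma pairing_add phi psi c :
  pairing (fun t => phi t (+) psi t) c = pairing phi c (+) pairing psi c.
Proof. exact: big_split. Qed.

Lemma pairing_scale (b : bool) phi c :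
  pairing (fun t => b && phi t) c = b && pairing phi c.
Proof. by rewrite /pairing big_distrr. Qed.

Lemma eq_pairing phi psi c : phi =1 psi -> pairing phi c = pairing psi c.
Proof. by move=> e; apply: eq_bigr => t _; exact: e. Qed.

Lemma pairing_boundary phi c :
  pairing phi (boundary c) = pairing (coboundary phi) c.
Proof. exact: pairing_flatten. Qed.

Lemma coboundary_cons phi v t :
  coboundary phi (v :: t) = phi t (+) coboundary (fun u => phi (v :: u)) t.
Proof. by rewrite /coboundary /= pairing_cons pairing_map. Qed.

(** The dual of [boundary (boundary c) = 0].  Writing a tuple as a cone, the
coboundary of the base appears twice and the rest is the same statement for the
base. *)
Lemma coboundaryK phi t : coboundary (coboundary phi) t = false.
Proof.
elim: t phi => [|v t IH] phi; first exact: pairing_nil.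
rewrite coboundary_cons {2}/coboundary.
under eq_pairing => u do rewrite coboundary_cons.
by rewrite pairing_add -!/(coboundary _ _) IH addbF addbb.
Qed.

Lemma pairing_boundary_cone phi p c :
  pairing phi (boundary [seq p :: t | t <- c]) =
  pairing phi c (+) pairing (fun t => phi (p :: t)) (boundary c).
Proof.
rewrite !pairing_boundary pairing_map.
by under eq_pairing => t do rewrite coboundary_cons; rewrite pairing_add.
Qed.

End Chains.

(** * Cup products of coboundaries of sign functions *)

Section CupProduct.
Variables (V : zmodType) (I : eqType) (s : I -> V -> bool).
Implicit Types (t u : seq V) (c : seq (seq V)) (phi : seq V -> bool).
Implicit Types (i j : I) (r : seq I).

Definition antipode_chain c : seq (seq V) := [seq [seq - v | v <- t] | t <- c].

(** The cup product of the coboundaries of the 0-cochains [s i], for [i] in [r],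
as it acts on tuples of size [(size r).+1]. *)
Fixpoint cup r t : bool :=
  match r, t with
  | i :: r', v :: ((w :: _) as t') => (s i v (+) s i w) && cup r' t'
  | _, _ => true
  end.

(** The cup product of the 0-cochain [s i] itself with [cup r]: a primitive of
[cup (i :: r)]. *)
Definition cup_from i r t : bool :=
  if t is v :: _ then s i v && cup r t else false.

(** A cup product of cocycles is a cocycle.  Once [v] and [w] are split off, all
faces that keep both carry the common factor [s i v (+) s i w], so that the
cocycle equation for [r] turns their sum into the contributions of the two
remaining faces. *)
Lemma coboundary_cup r t : size t = (size r).+2 ->
  coboundary (cup r) t = false.
Proof.
elim: r t => [|i r IH] [|v [|w t]] //=.
  by case: t => // _; rewrite /coboundary /= !pairing_cons pairing_nil.
move=> [st]; rewrite !coboundary_cons /=.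
have /= := IH (w :: t); rewrite st => /(_ erefl).
rewrite coboundary_cons => /(canRL (addKb _)); rewrite addbF.
rewrite [X in _ (+) (_ (+) X)]pairing_scale -/(coboundary _ _) => ->.
case: t st => // x t _.
by case: (s i v) (s i w) (s i x) (cup r _) => [] [] [] [].
Qed.

(** Leibniz rule, where the second term vanishes because [cup r] is a cocycle. *)
Lemma coboundary_cup_from i r t : size t = (size r).+2 ->
  coboundary (cup_from i r) t = cup (i :: r) t.
Proof.
case: t => [|v [|w t]] // st; have := coboundary_cup st.
rewrite !(coboundary_cons _ v) => /(canRL (addKb _)); rewrite addbF => e.
rewrite [X in _ (+) X]pairing_scale -/(coboundary _ _) e /=.
by case: (s i v) (s i w) (cup r _) => [] [] [].
Qed.

(** Each factor [s i v (+) s i w] is unchanged when both signs are flipped. *)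
Lemma cup_antipode r t :
  (forall i v, i \in r -> v \in t -> s i (- v) = ~~ s i v) ->
  cup r [seq - v | v <- t] = cup r t.
Proof.
elim: r t => [|i r IH] [|v [|w t]] //= odd_s.
rewrite !(odd_s i) ?inE ?eqxx ?orbT //.
rewrite addNb addbN negbK; congr (_ && _); apply: (IH (w :: t)) => j v' jr v'wt.
by apply: odd_s; rewrite in_cons ?jr ?v'wt orbT.
Qed.

(** The first factor [s i v] is flipped while the others are invariant, and
[s i v (+) ~~ s i v] is [true]. *)
Lemma cup_from_antipode i r t : t != [::] ->
  (forall j v, j \in i :: r -> v \in t -> s j (- v) = ~~ s j v) ->
  cup_from i r t (+) cup_from i r [seq - v | v <- t] = cup r t.
Proof.
case: t => // v t _ odd_s.
have e : cup r [seq - w | w <- v :: t] = cup r (v :: t).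
  by apply: cup_antipode => j w jr wt; apply: odd_s => //; rewrite in_cons jr orbT.
rewrite /= in e *; rewrite e odd_s ?mem_head //.
by case: (s i v) (cup _ _) => [] [].
Qed.

(** The chains [c d] behave as hemispheres of increasing dimension: the boundary
of [c d.+1] is [c d] plus its antipode.  Replacing [cup (i :: r)] by the
coboundary of its primitive, moving it to the boundary, and folding the two
halves of that boundary onto each other removes [i]. *)
Lemma pairing_cup_hemispheres (c : nat -> seq (seq V)) r :
  pairing xpredT (c 0) ->
  (forall d phi, (d < size r)%N -> pairing phi (boundary (c d.+1)) =
     pairing phi (c d ++ antipode_chain (c d))) ->
  (forall d t, t \in c d -> size t = d.+1) ->
  (forall d t i v, (d < size r)%N -> t \in c d -> i \in r -> v \in t ->
     s i (- v) = ~~ s i v) ->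
  pairing (cup r) (c (size r)).
Proof.
move=> c0 cD size_c; elim: r cD => [|i r IH] cD odd_s.
  by move: c0; congr is_true; apply: eq_bigr => -[|? []].
have {IH} : pairing (cup r) (c (size r)).
  apply: IH => [d phi lt_d|d t j v lt_d ct jr vt]; first exact/cD/ltnW.
  by apply: odd_s ct _ vt; [exact: ltnW|rewrite in_cons jr orbT].
congr is_true; transitivity (pairing (cup_from i r) (boundary (c (size r).+1))).
  rewrite cD //= pairing_cat pairing_map -pairing_add.
  apply: eq_big_seq => t ct; rewrite cup_from_antipode //.
    by rewrite -size_eq0 (size_c _ _ ct).
  by move=> j v jr vt; apply: odd_s ct jr vt => /=.
rewrite pairing_boundary; apply: eq_big_seq => t ct.
by rewrite coboundary_cup_from // (size_c _ _ ct).
Qed.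

(** If [s i] is constant on a tuple then its coboundary vanishes on every edge of
that tuple, in particular on the one that enters the product. *)
Lemma cup_eq0 i r t : i \in r -> size t = (size r).+1 ->
  (forall v w, v \in t -> w \in t -> s i v = s i w) -> cup r t = false.
Proof.
elim: r t => // j r IH [|v [|w t]] //; rewrite in_cons /=.
have [->|_] /= := eqVneq i j; move=> ir [st] cst.
  by rewrite (cst v w) ?addbb // !inE eqxx ?orbT.
rewrite (IH (w :: t)) ?andbF //= ?st // => v' w' v't w't.
by apply: cst; rewrite in_cons ?v't ?w't orbT.
Qed.

End CupProduct.

(** * Hemispheres of the octahedral sphere *)

Section Antipode.
Variable V : zmodType.
Implicit Types (t u : seq V) (c : seq (seq V)).

Lemma size_faces t u : u \in faces t -> size t = (size u).+1.
Proof.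
elim: t u => // v t IH u; rewrite in_cons => /predU1P[->//|].
by move=> /mapP[u' /IH st ->]; rewrite /= st.
Qed.

Lemma mem_faces t u v : u \in faces t -> v \in u -> v \in t.
Proof.
elim: t u => // w t IH u; rewrite in_cons => /predU1P[->|/mapP[u' u't ->]].
  by rewrite in_cons => ->; rewrite orbT.
by rewrite !in_cons => /orP[->//|/(IH _ u't)->]; rewrite orbT.
Qed.

Lemma faces_antipode t : faces [seq - v | v <- t] = antipode_chain (faces t).
Proof.
elim: t => //= v t ->; congr cons.
by rewrite /antipode_chain -!map_comp; apply: eq_map.
Qed.

Lemma boundary_antipode c :
  boundary (antipode_chain c) = antipode_chain (boundary c).
Proof.
rewrite /boundary {2}/antipode_chain map_flatten -!map_comp.
by congr flatten; apply: eq_map => t /=; exact: faces_antipode.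
Qed.

Lemma pairing_boundaryK phi c : pairing phi (boundary (boundary c)) = false.
Proof.
rewrite !pairing_boundary /pairing big1 // => t _; exact: coboundaryK.
Qed.

Variable e : nat -> V.

(** When [e] enumerates the unit vectors, [hemisphere d] triangulates the half
with nonnegative last coordinate of the [d]-dimensional octahedral sphere: it is
the cone with apex [e d] over the octahedral sphere of dimension [d - 1], made of
two opposite hemispheres. *)
Fixpoint hemisphere (d : nat) : seq (seq V) :=
  if d is d'.+1 then
    [seq e d :: t | t <- hemisphere d' ++ antipode_chain (hemisphere d')]
  else [:: [:: e 0]].

Lemma boundary_cat c1 c2 : boundary (c1 ++ c2) = boundary c1 ++ boundary c2.
Proof. by rewrite /boundary map_cat flatten_cat. Qed.

(** The boundary of a cone is its base plus the cone over the boundary of the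
base.  Here the base is a hemisphere plus its antipode, hence a cycle: by
induction the two boundaries are the same antipode-invariant chain. *)
Lemma pairing_boundary_hemisphere d phi :
  pairing phi (boundary (hemisphere d.+1)) =
  pairing phi (hemisphere d ++ antipode_chain (hemisphere d)).
Proof.
rewrite pairing_boundary_cone boundary_cat boundary_antipode.
set psi := (fun t => _); set A := pairing phi _.
suff -> : pairing psi (boundary (hemisphere d) ++
  antipode_chain (boundary (hemisphere d))) = false by rewrite addbF.
rewrite {}/A; elim: d psi => [|d IH] psi; first
  by rewrite /= !pairing_cons pairing_nil addbF addbb.
rewrite pairing_cat pairing_map.
have step phi' : pairing phi' (boundary (hemisphere d.+1)) =
    pairing phi' (hemisphere d ++ antipode_chain (hemisphere d)).
  by rewrite pairing_boundary_cone boundary_cat boundary_antipode IH addbF.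
have negK : (fun t => psi [seq - v | v <- [seq - v | v <- t]]) =1 psi.
  by move=> t; rewrite mapK //; exact: opprK.
rewrite !step !pairing_cat !pairing_map (eq_pairing _ negK).
by rewrite addbA addbK addbb.
Qed.

Lemma size_hemisphere d t : t \in hemisphere d -> size t = d.+1.
Proof.
elim: d t => [|d IH] t /=; first by rewrite inE => /eqP->.
move=> /mapP[u]; rewrite mem_cat => /orP[/IH <- ->//|/mapP[u' /IH <- ->] ->].
by rewrite /= size_map.
Qed.

End Antipode.

(** * Barycentric subdivision *)

Section Subdivision.
Variables (R : realType) (V : normedModType R).
Implicit Types (t u : seq V) (c : seq (seq V)) (phi : seq V -> bool).

Definition barycenter t : V := (size t)%:R^-1 *: \sum_(v <- t) v.

(** The cone from the barycenter over the subdivided boundary.  The argument [n]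
is the size of the tuple and only makes the recursion structural. *)
Fixpoint sd_simplex n t : seq (seq V) :=
  if n is n'.+1 then
    [seq barycenter t :: u | u <- flatten [seq sd_simplex n' f | f <- faces t]]
  else [:: [::]].

Definition sd c : seq (seq V) := flatten [seq sd_simplex (size t) t | t <- c].

Lemma mem_sd c u : u \in sd c -> exists2 t, t \in c & u \in sd_simplex (size t) t.
Proof. by move=> /flatten_mapP. Qed.

Lemma sd_simplex_ind (Q : seq V -> seq V -> Prop) :
  Q [::] [::] ->
  (forall t f u, f \in faces t -> u \in sd_simplex (size f) f -> Q f u ->
    Q t (barycenter t :: u)) ->
  forall t u, u \in sd_simplex (size t) t -> Q t u.
Proof.
move=> Q0 QS t; move: {2}(size t) (erefl (size t)) => n.
elim: n t => [|n IH] t st u; rewrite st /=.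
  by rewrite inE => /eqP->; move/size0nil: st => ->.
move=> /mapP[u' /flatten_mapP[f ft u'f] ->].
have := size_faces ft; rewrite st => -[sf].
by apply: (QS _ _ _ ft); last apply: IH; rewrite -sf.
Qed.

Lemma size_sd_simplex t u : u \in sd_simplex (size t) t -> size u = size t.
Proof.
move: t u; apply: sd_simplex_ind => // t f u ft _ /= ->.
by rewrite (size_faces ft).
Qed.

(** Subdivision commutes with the boundary: the cone formula leaves, besides the
subdivided boundary, the cone over the boundary of the subdivided boundary.  The
latter is by induction the subdivision of the boundary of the boundary. *)
Lemma pairing_boundary_sd_simplex phi n t : size t = n ->
  pairing phi (boundary (sd_simplex n t)) = pairing phi (sd (faces t)).
Proof.
elim: n t phi => [|n IH] t phi st; first by move/size0nil: st => ->.
rewrite pairing_boundary_cone.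
have -> : sd (faces t) = flatten [seq sd_simplex n f | f <- faces t].
  congr flatten; apply/eq_in_map => f /size_faces; rewrite st => -[<-//].
rewrite pairing_boundary [X in _ (+) X]pairing_flatten.
set psi := fun u => phi (_ :: u).
suff -> : pairing (fun f => pairing (coboundary psi) (sd_simplex n f)) (faces t)
  = false by rewrite addbF.
rewrite -[RHS](pairing_boundaryK (fun f => pairing psi (sd_simplex (size f) f)) [:: t]).
rewrite /boundary /= cats0 pairing_boundary; apply: eq_big_seq => f ft.
rewrite -pairing_boundary IH; first by rewrite /sd pairing_flatten.
by have := size_faces ft; rewrite st => -[].
Qed.

Lemma pairing_sd phi c :
  pairing phi (sd c) = pairing (fun t => pairing phi (sd_simplex (size t) t)) c.
Proof. exact: pairing_flatten. Qed.

Lemma pairing_boundary_sd phi c :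
  pairing phi (boundary (sd c)) = pairing phi (sd (boundary c)).
Proof.
rewrite pairing_boundary !pairing_sd pairing_boundary; apply: eq_pairing => t.
by rewrite -pairing_boundary pairing_boundary_sd_simplex // pairing_sd.
Qed.

Lemma barycenter_antipode t : barycenter [seq - v | v <- t] = - barycenter t.
Proof. by rewrite /barycenter size_map big_map sumrN scalerN. Qed.

Lemma sd_simplex_antipode n t :
  sd_simplex n [seq - v | v <- t] = antipode_chain (sd_simplex n t).
Proof.
elim: n t => //= n IH t; rewrite faces_antipode barycenter_antipode.
have -> : flatten [seq sd_simplex n f | f <- antipode_chain (faces t)] =
    antipode_chain (flatten [seq sd_simplex n f | f <- faces t]).
  rewrite /antipode_chain map_flatten -!map_comp; congr flatten.
  by apply: eq_map => f /=; rewrite IH.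
by rewrite /antipode_chain -!map_comp; apply: eq_map.
Qed.

Lemma sd_antipode c : sd (antipode_chain c) = antipode_chain (sd c).
Proof.
rewrite /sd {2}/antipode_chain map_flatten -!map_comp; congr flatten.
by apply: eq_map => t /=; rewrite size_map sd_simplex_antipode.
Qed.

Lemma sd_cat c1 c2 : sd (c1 ++ c2) = sd c1 ++ sd c2.
Proof. by rewrite /sd map_cat flatten_cat. Qed.

(** Subdivision respects both operations in the boundary relation of the
hemispheres, so that the subdivided hemispheres satisfy it too. *)
Lemma pairing_boundary_iter_sd N c c' :
  (forall phi, pairing phi (boundary c) = pairing phi (c' ++ antipode_chain c')) ->
  forall phi, pairing phi (boundary (iter N sd c)) =
    pairing phi (iter N sd c' ++ antipode_chain (iter N sd c')).
Proof.
move=> cc'; elim: N => //= N IH phi.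
by rewrite pairing_boundary_sd pairing_sd IH -pairing_sd sd_cat sd_antipode.
Qed.

Lemma iter_sd_invariant (Q : seq V -> Prop) :
  (forall t u, Q t -> u \in sd_simplex (size t) t -> Q u) ->
  forall N c, (forall t, t \in c -> Q t) -> forall u, u \in iter N sd c -> Q u.
Proof.
move=> Qsd; elim=> //= N IH c Qc u /mem_sd[t tc]; apply: Qsd.
exact: IH tc.
Qed.

(** The part of convexity that subdivision uses. *)
Definition barycenter_closed (P : V -> Prop) :=
  forall t, t != [::] -> (forall v, v \in t -> P v) -> P (barycenter t).

Lemma sd_simplex_closed (P : V -> Prop) t u : barycenter_closed P ->
  u \in sd_simplex (size t) t -> (forall v, v \in t -> P v) ->
  forall v, v \in u -> P v.
Proof.
move=> clP; move: t u; apply: sd_simplex_ind => // t f u ft _ IH Pt v.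
rewrite in_cons => /predU1P[->|]; last by apply: IH => w /(mem_faces ft)/Pt.
by apply: clP => //; rewrite -size_eq0 (size_faces ft).
Qed.

Lemma barycenter_closed_ball (x : V) (r : R) :
  barycenter_closed (fun v => `|x - v| <= r).
Proof.
move=> t t0 tr; have st : (size t)%:R != 0 :> R by rewrite pnatr_eq0 size_eq0.
have -> : x - barycenter t = (size t)%:R^-1 *: \sum_(v <- t) (x - v).
  rewrite sumrB big_const_seq count_predT iter_addr_0 scalerBr.
  by rewrite -[x *+ _]scaler_nat scalerK.
rewrite normrZ normfV normr_nat ler_pdivrMl ?lt0r ?st ?ler0n //.
apply: le_trans (ler_norm_sum _ _ _) _; rewrite mulr_natl.
rewrite big_seq; apply: le_trans (ler_sum _ tr) _.
by rewrite -big_seq big_const_seq count_predT iter_addr_0.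
Qed.

Definition diam_le (r : R) t := forall v w, v \in t -> w \in t -> `|v - w| <= r.

(** Among the [size t] differences [w - v] averaged here, one is zero: this is
where the contraction factor comes from. *)
Lemma dist_barycenter N r t v : (size t <= N)%N -> diam_le r t -> v \in t ->
  `|barycenter t - v| <= (1 - N%:R^-1) * r.
Proof.
move=> stN tr vt; have st0 : (0 < size t)%N by case: (t) vt.
have st : (0 : R) < (size t)%:R by rewrite ltr0n.
have r0 : 0 <= r by apply: le_trans (tr v v vt vt).
have -> : barycenter t - v = (size t)%:R^-1 *: \sum_(w <- t) (w - v).
  rewrite sumrB big_const_seq count_predT iter_addr_0 scalerBr.
  by rewrite -[v *+ _]scaler_nat scalerK // gt_eqF.
apply: (@le_trans _ _ ((1 - (size t)%:R^-1) * r)); last first.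
  by rewrite ler_wpM2r // lerD2l lerN2 lef_pV2 ?posrE ?ler_nat // ltr0n (leq_trans st0).
rewrite normrZ normfV normr_nat ler_pdivrMl // mulrA mulrBr mulr1 mulfV ?gt_eqF //.
rewrite (big_rem v) //= subrr add0r; apply: le_trans (ler_norm_sum _ _ _) _.
rewrite big_seq (le_trans (ler_sum _ (G := fun=> r) _)) //.
  by move=> w /mem_rem wt; exact: tr.
rewrite -big_seq big_const_seq count_predT iter_addr_0 size_rem //.
by rewrite -(natrB _ st0) mulr_natl subn1.
Qed.

(** Two points of a subdivided simplex either both lie in a subdivided face,
where induction applies, or one of them is the barycenter.  The ball about the
barycenter that contains the vertices contains the other point by convexity. *)
Lemma sd_simplex_diam N r t u : (size t <= N)%N -> diam_le r t ->
  u \in sd_simplex (size t) t -> diam_le ((1 - N%:R^-1) * r) u.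
Proof.
move=> + + ut; move: t u ut; apply: sd_simplex_ind => // t f u ft uf IH stN tr.
have st := size_faces ft.
have t0 : t != [::] by rewrite -size_eq0 st.
have r0 : 0 <= (1 - N%:R^-1) * r.
  case: t t0 tr stN st {IH ft} => // v t _ tr stN _.
  by apply: le_trans (dist_barycenter stN tr (mem_head _ _)).
have bu v : v \in u -> `|barycenter t - v| <= (1 - N%:R^-1) * r.
  apply: sd_simplex_closed (@barycenter_closed_ball _ _) uf _ v => v.
  by move/(mem_faces ft); exact: dist_barycenter.
have fr : diam_le r f by move=> v w /(mem_faces ft) vt /(mem_faces ft); exact: tr.
have {}IH : diam_le ((1 - N%:R^-1) * r) u.
  by apply: IH fr; rewrite (leq_trans _ stN) // st.
move=> v w; rewrite !in_cons => /predU1P[->|vu] /predU1P[->|wu].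
- by rewrite subrr normr0.
- exact: bu.
- by rewrite distrC bu.
- exact: IH.
Qed.

Lemma iter_sd_diam N M r c :
  (forall t, t \in c -> (size t <= N)%N /\ diam_le r t) ->
  forall u, u \in iter M sd c ->
  (size u <= N)%N /\ diam_le ((1 - N%:R^-1) ^+ M * r) u.
Proof.
move=> cr; elim: M => [|M IH] u /=; first by rewrite expr0 mul1r; exact: cr.
move=> /mem_sd[t /IH[stN tr] ut]; split; first by rewrite (size_sd_simplex ut).
by rewrite exprS -mulrA; exact: sd_simplex_diam ut.
Qed.

Lemma iter_sd_vertex N v : exists w, iter N sd [:: [:: v]] = [:: [:: w]].
Proof.
by elim: N => [|N [w IH]]; [exists v|exists (barycenter [:: w])]; rewrite //= IH.
Qed.

End Subdivision.

(** * Signs of functions without common zero on a compact set *)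

(** A Lebesgue number for the cover of [K] by the sets where [F i] is positive or
where [F i] is negative. *)
Lemma sign_lebesgue_number (R : realType) (V : normedModType R) (m : nat)
    (F : 'I_m -> V -> R) (K : set V) : compact K ->
  (forall i x, K x -> {for x, continuous (F i)}) ->
  (forall x, K x -> exists i, F i x != 0) ->
  exists2 r : R, 0 < r &
    forall x, K x -> exists i, forall y, `|x - y| < r -> 0 < F i x * F i y.
Proof.
move=> /compact_near_coveringP cptK contF nzF.
pose P (r : R) x := exists i, forall y, `|x - y| < r -> 0 < F i x * F i y.
have : \forall r \near 0^'+, K `<=` P r.
  apply: cptK => x Kx; have [i Fix0] := nzF x Kx.
  have /nbhs_ballP[e /= e0 xe] : \forall y \near x, 0 < F i x * F i y.
    have : (fun y => F i x * F i y) @ x --> F i x * F i x.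
      by apply: cvgM; [exact: cvg_cst|exact: contF].
    by move=> /cvgr_gt; apply; rewrite -expr2 exprn_even_gt0.
  rewrite -ball_normE /= in xe.
  have e20 : 0 < e / 2 by rewrite divr_gt0.
  near=> x' r; exists i => y x'y.
  have xx' : `|x - x'| < e / 2.
    by near: x'; apply: cvgr_dist_lt e20; exact: cvg_id.
  have re : r < e / 2 by near: r; exact: nbhs_right_lt.
  have Fx' : 0 < F i x * F i x'.
    by apply: xe => /=; apply: lt_trans xx' _; rewrite ltr_pdivrMr // ltr_pMr // ltr1n.
  have Fy : 0 < F i x * F i y.
    apply: xe => /=; rewrite (splitr e) -(subrKA x' x).
    by apply: le_lt_trans (ler_normD _ _) _; rewrite ltrD // (lt_trans x'y).
  have : 0 < (F i x * F i x) * (F i x' * F i y) by rewrite mulrACA mulr_gt0.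
  by rewrite pmulr_rgt0 // -expr2 exprn_even_gt0.
move=> KP; have [r [r0 Kr]] := filter_ex (filterI (nbhs_right_gt (0 : R)) KP).
by exists r.
Unshelve. all: by end_near. Qed.

(** * The Borsuk-Ulam theorem *)

Section BorsukUlam.
Variables (R : realType) (k : nat).
Local Notation V := 'rV[R]_k.+1.

(** A compact set that avoids the origin and contains every subdivision of the
octahedral sphere; here [`|x|] is the sup norm. *)
Definition octahedral_shell : set V :=
  [set x : V | `|x| <= 1 /\ 1 <= \sum_j `|x 0 j|].

Lemma octahedral_shell_compact : compact octahedral_shell.
Proof.
apply: bounded_closed_compact.
  by exists 1; split=> // M M1 x [x1 _]; exact: le_trans x1 (ltW M1).
apply: closedI.
  apply: (@closed_comp _ _ (fun x : V => `|x|) [set y | y <= 1]).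
    by move=> x _; exact: norm_continuous.
  exact: closed_le.
have l1_continuous : continuous (fun x : V => \sum_j `|x 0 j|).
  apply: continuous_big; first exact: add_continuous.
  move=> j _ x; apply: continuous_comp; first exact: coord_continuous.
  exact: norm_continuous.
apply: (@closed_comp _ _ (fun x : V => \sum_j `|x 0 j|) [set y | 1 <= y]).
  by move=> x _; exact: l1_continuous.
exact: closed_ge.
Qed.

Lemma octahedral_shell_neq0 x : octahedral_shell x -> x != 0.
Proof.
move=> [_ x1]; apply/eqP => x0; move: x1; rewrite x0 big1 ?ler10 // => j _.
by rewrite mxE normr0.
Qed.

Definition vertex (d : nat) : V := delta_mx 0 (inord d).

(** For a sign vector [eps], this holds on the face of the octahedron whose
vertices are the signed unit vectors [eps 0 j *: vertex j]. *)
Definition in_octahedral_face (eps x : V) := dot eps x = 1 /\ `|x| <= 1.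

(** Entries of absolute value at most [1] are what bounds [dot eps x] by the l1
norm of [x]. *)
Definition face_normal (eps : V) := forall j, `|eps 0 j| <= 1.

Lemma octahedral_face_shell eps x : face_normal eps ->
  in_octahedral_face eps x -> octahedral_shell x.
Proof.
move=> eps1 [ex x1]; split=> //; rewrite -ex; apply: ler_sum => j _.
by apply: le_trans (ler_norm _) _; rewrite normrM ler_piMl.
Qed.

Lemma barycenter_closed_octahedral_face eps :
  barycenter_closed (in_octahedral_face eps).
Proof.
move=> t t0 te; split; last first.
  rewrite -normrN -[X in `|X|]add0r; apply: barycenter_closed_ball => // x /te[_].
  by rewrite sub0r normrN.
have dot_sum : dot eps (\sum_(v <- t) v) = \sum_(v <- t) dot eps v.
  apply: (big_morph (dot eps)) => [u v|]; first exact: dotDr.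
  by rewrite -(scale0r 0) dotZr mul0r.
rewrite dotZr dot_sum big_seq (eq_bigr (fun=> 1)) => [|v /te[]//].
rewrite -big_seq big_const_seq count_predT iter_addr_0 mulVf //.
by rewrite pnatr_eq0 size_eq0.
Qed.

(** The vanishing of the coordinates beyond [d] carries the induction: it leaves
the value of [dot eps x] unchanged when the coordinate [d.+1] of [eps] is reset
to [1] to accommodate the new apex. *)
Lemma hemisphere_face d t : (d <= k)%N -> t \in hemisphere vertex d ->
  exists2 eps, face_normal eps & forall x, x \in t ->
    in_octahedral_face eps x /\ forall j : 'I_k.+1, (d < j)%N -> x 0 j = 0.
Proof.
have norm_vertex i : `|vertex i| <= 1.
  rewrite [leLHS]/Num.Def.normr /= mx_normrE; apply: bigmax_le => // z _.
  by rewrite mxE ger0_norm ?ler0n // lern1; case: (_ && _).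
have dot_vertex eps i : dot eps (vertex i) = eps 0 (inord i).
  rewrite /dot (bigD1 (inord i)) //= big1 => [|j /negPf ne].
    by rewrite mxE !eqxx mulr1 addr0.
  by rewrite mxE ne andbF mulr0.
have vertex0 i (j : 'I_k.+1) : (i < j)%N -> vertex i 0 j = 0.
  move=> ij; rewrite mxE /=; case: eqP => // ji.
  by move: (ij); rewrite ji inordK ?ltnn // (ltn_trans ij (ltn_ord j)).
elim: d t => [|d IH] t dk /=.
  rewrite inE => /eqP->; exists (const_mx 1) => [j|x]; first by rewrite mxE normr1.
  rewrite inE => /eqP->; split; last exact: vertex0.
  by split; rewrite ?dot_vertex ?mxE.
move=> /mapP[t' t'd ->].
have {t'd IH} [eps eps1 eps_t'] : exists2 eps, face_normal eps & forall x, x \in t' ->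
    in_octahedral_face eps x /\ forall j : 'I_k.+1, (d < j)%N -> x 0 j = 0.
  move: t'd; rewrite mem_cat => /orP[|/mapP[t'' + ->]].
    by apply: IH; exact: ltnW.
  move=> /(IH _ (ltnW dk))[eps eps1 eps_t]; exists (- eps) => [j|x].
    by rewrite mxE normrN.
  move=> /mapP[y /eps_t[[ey y1] y0] ->].
  split; first by split; rewrite ?normrN // !dotE opprK.
  by move=> j /y0 yj0; rewrite mxE yj0 oppr0.
pose i : 'I_k.+1 := inord d.+1; have iE : i = d.+1 :> nat by rewrite inordK.
(* The old tuple has zero coordinate at [i], so only the apex sees this change. *)
exists (\row_j if j == i then 1 else eps 0 j) => [j|x].
  by rewrite mxE; case: eqP; rewrite ?normr1.
rewrite in_cons => /predU1P[->|xt'].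
  split; last exact: vertex0.
  by split; rewrite // dot_vertex mxE eqxx.
have [[ex x1] x0] := eps_t' x xt'; split; last by move=> j /ltnW; exact: x0.
split=> //; rewrite -ex; apply: eq_bigr => j _; rewrite mxE.
by case: eqP => // ->; rewrite x0 ?iE // !mulr0.
Qed.

Lemma odd_sign (F : V -> R) (pos : V -> bool) x :
  F (- x) = - F x -> pos (- x) = ~~ pos x ->
  (0 < F (- x)) || (F (- x) == 0) && pos (- x) =
  ~~ ((0 < F x) || (F x == 0) && pos x).
Proof.
move=> -> ->; rewrite oppr_gt0 oppr_eq0.
by case: (ltrgtP (F x) 0).
Qed.

(** An odd boolean function on nonzero vectors, which gives a sign at the zeros
of an odd real function. *)
Definition leading_positive (x : V) : bool :=
  if [pick j | x 0 j != 0] is Some j then 0 < x 0 j else false.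

Lemma leading_positiveN x : x != 0 -> leading_positive (- x) = ~~ leading_positive x.
Proof.
move=> x0; rewrite /leading_positive.
rewrite (eq_pick (Q := fun j => x 0 j != 0)); last by move=> j; rewrite /= mxE oppr_eq0.
case: pickP => [j xj|x_eq0]; last first.
  by case/eqP: x0; apply/rowP => j; have := x_eq0 j; rewrite mxE => /eqP.
by rewrite mxE oppr_gt0 -leNgt le_eqVlt (negPf xj).
Qed.

(** Working on nonzero vectors rather than on unit vectors leaves the octahedral
simplices flat. *)
Lemma borsuk_ulam_punctured (m : nat) (F : 'I_m -> V -> R) : (m <= k)%N ->
  (forall i x, x != 0 -> {for x, continuous (F i)}) ->
  (forall i x, x != 0 -> F i (- x) = - F i x) ->
  exists2 x, x != 0 & forall i, F i x = 0.
Proof.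
move=> mk contF oddF; apply: contrapT => nozero.
have nzF x : octahedral_shell x -> exists i, F i x != 0.
  move=> /octahedral_shell_neq0 x0; apply: contrapT => F0; apply: nozero.
  by exists x => // i; apply: contrapT => /eqP Fi; apply: F0; exists i.
have [r r0 rF] := sign_lebesgue_number octahedral_shell_compact
  (fun i x Kx => contF i x (octahedral_shell_neq0 Kx)) nzF.
(* The contraction factor for tuples of [m.+1] points; the diameter is at most
[2] at the start. *)
pose q : R := 1 - m.+1%:R^-1.
have [N qN] : exists N, q ^+ N * 2 < r.
  have q0 : 0 <= q by rewrite subr_ge0 invf_le1 // ler1n.
  have q1 : `|q| < 1 by rewrite ger0_norm // gtrBl invr_gt0.
  have r20 : 0 < r / 2 by rewrite divr_gt0.
  have /cvgr_dist_lt/(_ _ r20)[N _ /(_ N (leqnn N))] := cvg_expr q1.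
  rewrite sub0r normrN ger0_norm ?exprn_ge0 // => qN; exists N.
  by rewrite -ltr_pdivlMr.
pose c d := iter N (@sd R V) (hemisphere vertex d).
have face_c d t : (d <= k)%N -> t \in c d ->
    exists2 eps, face_normal eps & forall x, x \in t -> in_octahedral_face eps x.
  move=> dk; move: t; apply: iter_sd_invariant.
    move=> t u [eps eps1 et] ut; exists eps => //.
    exact: sd_simplex_closed (@barycenter_closed_octahedral_face eps) ut et.
  by move=> t /(hemisphere_face dk)[eps eps1 et]; exists eps => // x /et[].
have shell_c d t x : (d <= k)%N -> t \in c d -> x \in t -> octahedral_shell x.
  by move=> dk /(face_c _ _ dk)[eps eps1 et] /et; exact: octahedral_face_shell.
have size_c d t : t \in c d -> size t = d.+1.
  move: t; apply: iter_sd_invariant => [t u <- /size_sd_simplex //|t].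
  exact: size_hemisphere.
have small_c t : t \in c m -> forall x y, x \in t -> y \in t -> `|x - y| < r.
  move=> tc; have [] := @iter_sd_diam _ _ m.+1 N 2 (hemisphere vertex m) _ t tc.
    move=> u um; split; first by rewrite (size_hemisphere um).
    have [eps _ eu] := hemisphere_face mk um.
    move=> x y /eu[[_ x1] _] /eu[[_ y1] _].
    by apply: le_trans (ler_normB _ _) _; rewrite (natrD _ 1 1) lerD.
  by move=> _ tr x y xt yt; apply: le_lt_trans (tr x y xt yt) qN.
pose s i x := (0 < F i x) || (F i x == 0) && leading_positive x.
have : pairing (cup s (enum 'I_m)) (c (size (enum 'I_m))).
  have sz : size (enum 'I_m) = m by rewrite size_enum_ord.
  apply: pairing_cup_hemispheres => //.
  - rewrite /c /=; have [w ->] := iter_sd_vertex N (vertex 0).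
    by rewrite /pairing big_seq1.
  - move=> d phi _; apply: pairing_boundary_iter_sd => phi'.
    exact: pairing_boundary_hemisphere.
  - move=> d t i x; rewrite sz => dm tc _ xt.
    have x0 := octahedral_shell_neq0 (shell_c _ _ _ (leq_trans (ltnW dm) mk) tc xt).
    by apply: odd_sign; [exact: oddF|exact: leading_positiveN].
rewrite size_enum_ord /pairing big_seq big1 // => t tc.
have [x xt] : exists x, x \in t.
  by have := size_c _ _ tc; case: (t) => // x ? _; exists x; exact: mem_head.
have [i ri] := rF x (shell_c _ _ _ mk tc xt).
have const_s y : y \in t -> s i y = s i x.
  move=> yt; have := ri y (small_c _ tc _ _ xt yt).
  by rewrite /s; case: (ltrgtP (F i x) 0) => [Fx|Fx|->];
    rewrite ?mul0r ?ltxx // ?(nmulr_rgt0 _ Fx) ?(pmulr_rgt0 _ Fx) => Fy;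
    case: (ltrgtP (F i y) 0) Fy.
apply: (@cup_eq0 _ _ _ i).
- by rewrite mem_enum.
- by rewrite size_enum_ord (size_c _ _ tc).
- by move=> v w /const_s-> /const_s->.
Qed.

End BorsukUlam.

Section RadialProjection.
Variables (R : realType) (k : nat).
Local Notation V := 'rV[R]_k.+1.
Local Notation S := (sphere R k).

Lemma pole_subproof : enorm (delta_mx 0 0 : V) == 1.
Proof.
rewrite /enorm /dot (bigD1 0) //= big1 => [|j j0].
  by rewrite !mxE eqxx mulr1 addr0 sqrtr1.
by rewrite !mxE (negPf j0) mulr0.
Qed.

Definition pole : S := Sphere pole_subproof.

Lemma dot_gt0 (x : V) : x != 0 -> 0 < dot x x.
Proof.
move=> x0; rewrite lt_neqAle dot_ge0 andbT eq_sym.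
by apply: contra_neq x0; exact: dot_eq0.
Qed.

Lemma enorm_gt0 (x : V) : x != 0 -> 0 < enorm x.
Proof. by move=> x0; rewrite sqrtr_gt0 dot_gt0. Qed.

Definition radial_proj (x : V) : S := insubd pole ((enorm x)^-1 *: x).

Lemma val_radial_proj x : x != 0 ->
  radial_proj x = (enorm x)^-1 *: x :> V.
Proof.
move=> x0; apply: insubdK; rewrite -topredE /= /enorm dotZl dotZr mulrA -expr2.
rewrite exprVn sqr_sqrtr ?dot_ge0 // mulVf ?sqrtr1 //.
by rewrite gt_eqF // dot_gt0.
Qed.

Lemma radial_projN x : x != 0 -> radial_proj (- x) = sphere_opp (radial_proj x).
Proof.
move=> x0; apply: val_inj => /=; rewrite !val_radial_proj ?oppr_eq0 //.
by rewrite scalerN /enorm dotNl dotNr opprK.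
Qed.

Lemma dot_continuous (x : V) : continuous (dot x).
Proof.
apply: continuous_big; first exact: add_continuous.
by move=> j _ y; apply: continuousM; [exact: cst_continuous|exact: coord_continuous].
Qed.

Lemma dot_self_continuous : continuous (fun x : V => dot x x).
Proof.
apply: continuous_big; first exact: add_continuous.
by move=> j _ y; apply: continuousM; exact: coord_continuous.
Qed.

Lemma enorm_continuous : continuous (@enorm R k.+1).
Proof.
move=> x; apply: (@continuous_comp _ _ _ (fun x : V => dot x x) Num.sqrt).
  exact: dot_self_continuous.
exact: sqrt_continuous.
Qed.

(** For distances at most [pi], [geod x y < d] amounts to [cos d < dot x y], which
is an open condition because the inner product of the projections is
continuous. *)
Lemma radial_proj_continuous (x : V) : x != 0 -> {for x, continuous radial_proj}.
Proof.
move=> x0.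
have FF : Filter (nbhs x) by exact: nbhs_filter.
apply/(@cvg_ballP _ _ _ _ FF radial_proj (radial_proj x)) => e e0.
(* [cos] is only monotone on [0, pi]. *)
pose d := Num.min e pi.
have d0 : 0 < d by rewrite lt_min e0 pi_gt0.
have d_itv : d \in `[0, pi] by rewrite in_itv /= ltW //= ge_min lexx orbT.
have cosd : cos d < 1.
  by rewrite -cos0 ltr_cos // in_itv /= lexx pi_ge0.
have : (enorm x)^-1 * ((enorm y)^-1 * dot x y) @[y --> x] --> (1 : R).
  have -> : 1 = (enorm x)^-1 * ((enorm x)^-1 * dot x x) :> R.
    by rewrite mulrA -invfM -expr2 sqr_sqrtr ?dot_ge0 // mulVf // gt_eqF // dot_gt0.
  apply: cvgM; first exact: cvg_cst.
  apply: cvgM; last exact: dot_continuous.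
  by apply: cvgV; [rewrite gt_eqF // enorm_gt0|exact: enorm_continuous].
move=> /cvgr_gt/(_ _ cosd) near_cos.
have near0 : \forall y \near x, 0 < dot y y.
  by have /cvgr_gt := @dot_self_continuous x; apply; exact: dot_gt0.
near=> y; rewrite ballEmdist /=.
have y0 : y != 0.
  apply/eqP => y0; have : 0 < dot y y by near: y.
  by rewrite y0 /dot big1 ?ltxx // => j _; rewrite mxE mul0r.
have : geod (radial_proj x) (radial_proj y) < d.
  rewrite -ltr_cos ?in_itv /= ?geod_ge0 ?geod_lepi // cos_geod.
  by rewrite !val_radial_proj // dotZl dotZr; near: y.
by rewrite lt_min => /andP[].
Unshelve. all: by end_near. Qed.

Theorem borsuk_ulam (m : nat) (h : 'I_m -> S -> R) : (m <= k)%N ->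
  (forall i, continuous (h i)) ->
  (forall i x, h i (sphere_opp x) = - h i x) ->
  exists x, forall i, h i x = 0.
Proof.
move=> mk conth oddh.
have [||x _ hx] := @borsuk_ulam_punctured R k m (fun i x => h i (radial_proj x)) mk.
- move=> i x x0; apply: (@continuous_comp _ _ _ radial_proj (h i)).
    exact: radial_proj_continuous.
  exact: conth.
- by move=> i x x0; rewrite radial_projN.
by exists (radial_proj x).
Qed.

End RadialProjection.

(** * Linear extension of a function from the vertices to the realization *)

Section LinearExtension.
Variables (R : realType) (V : choiceType) (K : simplicial_complex V).
Variable phi : V -> R.

Definition linear_extension (w : realization R K) : R :=
  \sum_(v <- finsupp w) w v * phi v.

Lemma linear_extension_simplex (s : {fset V}) w : closed_simplex s w ->
  linear_extension w = \sum_(v <- s) w v * phi v.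
Proof.
move=> sw; apply: big_fset_incl => // v _.
by rewrite mem_finsupp negbK => /eqP->; rewrite mul0r.
Qed.

(** On one closed simplex this is a finite sum with fixed coefficients, and the
weak topology asks for no uniformity between simplices. *)
Lemma linear_extension_continuous : continuous linear_extension.
Proof.
apply/continuousP => A oA; suff : realization_open (linear_extension @^-1` A) by [].
move=> s Ks w sw Aw.
have /nbhs_ballP[e /= e0 eA] : nbhs (linear_extension w) A by exact: open_nbhs_nbhs.
pose M : R := \sum_(v <- s) `|phi v| + 1.
have M0 : 0 < M by rewrite ltr_wpDl // sumr_ge0.
exists (e / M) => [|w' sw' ww']; first by rewrite divr_gt0.
apply: eA; rewrite -ball_normE /=.
rewrite !(linear_extension_simplex (s := s)) // -sumrB.
apply: le_lt_trans (ler_norm_sum _ _ _) _.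
apply: (@le_lt_trans _ _ (\sum_(v <- s) e / M * `|phi v|)).
  rewrite big_seq [leRHS]big_seq; apply: ler_sum => v vs.
  by rewrite -mulrBl normrM ler_wpM2r // ltW // ww'.
rewrite -mulr_sumr mulrAC ltr_pdivrMr // ltr_pM2l // ltrDl //.
Qed.

End LinearExtension.

Lemma linear_extension_opp (R : realType) (X : metricType R)
    (i : isometric_involution X) (r : R) (phi : X -> R)
    (w : realization R (VR X r)) :
  (forall x, phi (i x) = - phi x) ->
  linear_extension phi (VR_opp i w) = - linear_extension phi w.
Proof.
move=> phiN; rewrite /linear_extension /= finsupp_VR_opp_coord big_imfset /=; last first.
  by move=> x y _ _ /(can_inj (involK i)).
rewrite -sumrN; apply: eq_bigr => x _.
by rewrite VR_opp_coordE involK phiN mulrN.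
Qed.

(** * Opposite spherical caps and small simplices *)

Section Caps.
Variables (R : realType) (n : nat).
Local Notation S := (sphere R n).
Implicit Types (x u v : S) (e r : R).

Definition cap_sign e x v : R :=
  (geod x v < e)%R%:R - (geod (sphere_opp x) v < e)%R%:R.

Lemma cap_sign_oppl e x v : cap_sign e (sphere_opp x) v = - cap_sign e x v.
Proof. by rewrite /cap_sign sphere_oppK opprB. Qed.

Lemma cap_sign_oppr e x v : cap_sign e x (sphere_opp v) = - cap_sign e x v.
Proof. by rewrite /cap_sign opprB -!geod_oppl sphere_oppK. Qed.

Lemma geod_antipode x v : geod (sphere_opp x) v = pi - geod x v.
Proof. by rewrite /geod dotNl acosN // sphere_dot_itv. Qed.

(** Since [v] is in the cap about [x], a vertex [u] in the opposite cap would
give [pi <= geod x v + geod v u + geod u (- x) < 2 * e + r].  So all vertices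
have value [0] or [1], and [v] has value [1]. *)
Lemma linear_extension_cap_sign_gt0 e x r (w : realization R (VR S r)) v :
  r < pi - 2 * e -> v \in finsupp w -> geod x v < e ->
  0 < linear_extension (cap_sign e x) w.
Proof.
move=> re vw xv; have /asboolP[w0 _ [_ wr]] := coordP w.
have r0 : 0 <= r := le_trans (diam_ge0 _) wr.
have [close _] := diam_leP (finsupp w) r0.
have far u : u \in finsupp w -> (geod (sphere_opp x) u < e) = false.
  move=> uw; apply/negbTE; rewrite -leNgt geod_antipode.
  have := geod_triangle v x u; have : geod v u <= r := close wr _ _ vw uw.
  lra.
rewrite /linear_extension (big_fsetD1 v) //= ltr_pwDl //.
  rewrite /cap_sign xv far // subr0 mulr1 lt_neqAle w0 andbT eq_sym.
  by rewrite -mem_finsupp.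
rewrite big_seq; apply: sumr_ge0 => u; rewrite in_fsetD1 => /andP[_ uw].
by rewrite mulr_ge0 // /cap_sign far // subr0 ler0n.
Qed.

End Caps.

(** * The lower bound *)

Section Bounds.
Variables (R : realType) (n : nat).

(** The midpoint of two antipodal points.  It gives a constant odd map, so that
the infimum defining [c_] is taken over a nonempty set. *)
Lemma VR_fixed_point (x : sphere R n) : exists w : realization R (VR (sphere R n) pi),
  VR_opp (sphere_antipode R n) w = w.
Proof.
pose s := [fset x; sphere_opp x]%fset.
pose w : {fsfun sphere R n -> R with 0} := [fsfun v in s => 2^-1].
have xNx : x != sphere_opp x.
  apply/eqP => /(congr1 (fun y : sphere R n => dot x y)).
  rewrite /= dotNr sphere_dot1 => one_eqN1.
  suff : (1 : R) < 1 by rewrite ltxx.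
  lra.
have ws : finsupp w = s.
  apply/fsetP => v; rewrite mem_finsupp fsfunE; case: ifP => //.
    by rewrite invr_eq0 pnatr_eq0.
  by rewrite eqxx.
have wP : `[< barycentric (VR (sphere R n) pi) w >].
  apply/asboolP; split.
  - by move=> v; rewrite fsfunE; case: ifP; rewrite ?invr_ge0.
  - rewrite ws /s big_fsetU1 ?in_fset1 // big_seq_fset1 !fsfunE !in_fset2 !eqxx orbT.
    by rewrite [RHS]splitr mul1r.
  - rewrite ws; split; first by apply/fset0Pn; exists x; rewrite in_fset2 eqxx.
    by apply/diam_leP => [|y z _ _]; [exact: pi_ge0|exact: geod_lepi].
exists (Realization wP); apply/val_inj/fsfunP => v /=; rewrite VR_opp_coordE.
have -> : sphere_antipode R n v = sphere_opp v by [].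
rewrite !fsfunE !in_fset2 (can_eq (@sphere_oppK R n)) orbC.
by rewrite -[x in sphere_opp v == x]sphere_oppK (can_eq (@sphere_oppK R n)).
Qed.

(** For [0 < k] the infimum defining [cov] is over a nonempty set, because a ball
of radius greater than [pi] is the whole space; so it is approached by radii of
actual covers. *)
Lemma cov_adherent (k : nat) (d : R) : (0 < k)%N -> cov (RP R n) k < d ->
  exists e, exists A : {fset RP R n}, [/\ e < d, (#|` A| <= k)%N &
    forall p, exists2 a, a \in A & geodRP a p < e].
Proof.
move=> k0; rewrite /cov; set E := (X in inf X) => covd.
pose p0 := \pi_(RP R n)%qT (pole R n).
have infE : has_inf E.
  split; last by exists 0 => e [/ltW].
  exists (pi + 1); split; first by rewrite ltr_wpDl // pi_ge0.
  exists [fset p0]%fset; rewrite cardfs1; split=> //.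
  rewrite -subTset => p _; exists p0; first exact: fset11.
  rewrite ballEmdist /=; apply: (@le_lt_trans _ _ pi); last by rewrite ltrDl.
  by rewrite /mdist /= /geodRP ge_min geod_lepi.
have d0 : 0 < d - inf E by rewrite subr_gt0.
have [e [e0 [A [Ak AT]]]] := inf_adherent d0 infE.
rewrite addrC subrK => ed; exists e, A; split=> // p.
have [a aA] : (\bigcup_(a in [set` A]) ball a e) p by rewrite AT.
by rewrite ballEmdist; exists a.
Qed.

Lemma no_odd_map_VR (k : nat) (e r : R) (A : {fset RP R n})
    (f : sphere R k -> realization R (VR (sphere R n) r)) :
  (#|` A| <= k)%N -> (forall p, exists2 a, a \in A & geodRP a p < e) ->
  r < pi - 2 * e ->
  ~ odd_map (@sphere_opp R k) (@VR_opp R _ (sphere_antipode R n) r) f.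
Proof.
move=> Ak coverA re [contf oddf].
pose a (i : 'I_#|` A|) : sphere R n := repr (tnth (in_tuple (enum_fset A)) i).
have [||x hx] := @borsuk_ulam R k _
  (fun i x => linear_extension (cap_sign e (a i)) (f x)) Ak.
- move=> i x; apply: (@continuous_comp _ _ _ f); first exact: contf.
  exact: linear_extension_continuous.
- move=> i x; rewrite oddf linear_extension_opp // => v; exact: cap_sign_oppr.
have /asboolP[_ _ [/fset0Pn[v vw] _]] := coordP (f x).
have [p pA] := coverA (\pi_(RP R n)%qT v).
have /tnthP[i pi_] : p \in in_tuple (enum_fset A) by [].
rewrite -[p]reprK geodRP_pi pi_ -/(a i) gt_min -geod_oppl => /orP[av|av].
  by have := linear_extension_cap_sign_gt0 re vw av; rewrite hx ltxx.
have := linear_extension_cap_sign_gt0 re vw av.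
rewrite (_ : linear_extension _ _ = - linear_extension (cap_sign e (a i)) (f x)).
  by rewrite hx oppr0 ltxx.
by rewrite /linear_extension -sumrN; apply: eq_bigr => u _; rewrite cap_sign_oppl mulrN.
Qed.

End Bounds.

Theorem theorem5p3 (R : realType) (n k : nat) (hn : (1 <= n)%N)
    (hnk : (n <= k)%N) :
  pi - 2 * cov (RP R n) k <= c_ R n k.
Proof.
apply: lb_le_inf.
  have [w wfix] := VR_fixed_point (pole R n).
  exists pi; split; first exact: pi_ge0.
  by exists (fun=> w); split=> [x|x]; [exact: cst_continuous|rewrite wfix].
move=> r [r0 [f oddf]]; rewrite leNgt; apply/negP => rcov.
have covr : cov (RP R n) k < (pi - r) / 2 by lra.
have [e [A [er Ak coverA]]] := cov_adherent (leq_trans hn hnk) covr.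
by apply: (no_odd_map_VR Ak coverA _ oddf); lra.
Qed.
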